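(* Let $n\ge 1$, let $a=\{a_I \mid I\in\mathbb{N}^n,\ |I|\ge 2\}$ be a set of commuting variables, and let $P(z)=\sum_{I\in\mathbb{N}^n,\,|I|\ge 2} a_I z^I\in\mathbb{C}[a][[z]]$ be the universal formal power series of order $\ge 2$ in $z=(z_1,\dots,z_n)$. For $m\ge 1$ set $$u_m(P)=\operatorname{Tr}\left((\operatorname{Hes} P)^m\right),\qquad v_m(P)=\Delta^m P^m .$$ For $k\ge 1$ let $\mathcal{U}_k(P)$ (resp. $\mathcal{V}_k(P)$) be the ideal of $\mathbb{C}[a][[z]]$ generated by $\{u_m(P)\mid 1\le m\le k\}$ (resp. $\{v_m(P)\mid 1\le m\le k\}$) and all their partial derivatives (with respect to $z_1,\dots,z_n$) of any order. Then for every $k\ge 1$, $\mathcal{U}_k(P)=\mathcal{V}_k(P)$ as ideals of $\mathbb{C}[a][[z]]$.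
   Context: $\mathbb{N}$ denotes the non-negative integers, $|I|=I_1+\dots+I_n$, $z^I=z_1^{I_1}\cdots z_n^{I_n}$. $\Delta=\sum_{i=1}^n \partial^2/\partial z_i^2$ and $\operatorname{Hes} P=\left(\frac{\partial^2 P}{\partial z_i\partial z_j}\right)$ is the Hessian matrix. *)

(* Defs.v *)
From HB Require Import structures.
From mathcomp Require Import all_boot all_order all_algebra.
From mathcomp Require Import boolp classical_sets reals.
From mathcomp Require Import complex.
(* monalg and mpoly both define 'X_{1..n}, mdeg, ...; the mpoly versions are
   the ones in force below. *)
From mathcomp.multinomials Require Import -(notations) monalg.
From mathcomp Require Import mpoly.

Set Implicit Arguments.
Unset Strict Implicit.
Unset Printing Implicit Defensive.

Import GRing.Theory.

Local Open Scope ring_scope.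
Local Open Scope classical_set_scope.

(* Formal power series A[[z_1, ..., z_n]]. A wrapper rather than a bare
   function type, because functions already carry the pointwise product. *)
Record mfps (n : nat) (A : Type) := MFps { mfcoef : 'X_{1..n} -> A }.

Lemma mfpsP (n : nat) (A : Type) (f g : mfps n A) :
  mfcoef f =1 mfcoef g -> f = g.
Proof. by case: f g => [f] [g] /= /funext ->. Qed.

HB.instance Definition _ (n : nat) (A : Type) := gen_eqMixin (mfps n A).
HB.instance Definition _ (n : nat) (A : Type) := gen_choiceMixin (mfps n A).

Section MFpsZmodule.
Context (n : nat) (A : zmodType).
Implicit Types f g h : mfps n A.

Definition mfps_zero : mfps n A := MFps (fun=> 0).
Definition mfps_opp f : mfps n A := MFps (fun m => - mfcoef f m).
Definition mfps_add f g : mfps n A := MFps (fun m => mfcoef f m + mfcoef g m).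

Fact mfps_addA : associative mfps_add.
Proof. by move=> f g h; apply: mfpsP => m /=; rewrite addrA. Qed.

Fact mfps_addC : commutative mfps_add.
Proof. by move=> f g; apply: mfpsP => m /=; rewrite addrC. Qed.

Fact mfps_add0 : left_id mfps_zero mfps_add.
Proof. by move=> f; apply: mfpsP => m /=; rewrite add0r. Qed.

Fact mfps_addN : left_inverse mfps_zero mfps_opp mfps_add.
Proof. by move=> f; apply: mfpsP => m /=; rewrite addNr. Qed.

HB.instance Definition _ := GRing.isZmodule.Build (mfps n A)
  mfps_addA mfps_addC mfps_add0 mfps_addN.

End MFpsZmodule.

Section MFpsRing.
Context (n : nat) (A : comNzRingType).
Implicit Types f g h : mfps n A.

Definition mfps_one : mfps n A := MFps (fun m => (m == 0%MM)%:R).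

(* The Cauchy product; the index set is that of mcoeffM, i.e. all pairs of
   exponents whose sum is m. *)
Definition mfps_mul f g : mfps n A := MFps (fun m =>
  \sum_(k : 'X_{1..n < (mdeg m).+1, (mdeg m).+1} | m == (k.1 + k.2)%MM)
    mfcoef f k.1 * mfcoef g k.2).

Definition mftrunc (d : nat) f : {mpoly A[n]} :=
  \sum_(k : 'X_{1..n < d}) mfcoef f k *: 'X_[k].

Lemma mcoeff_mftrunc d f (m : 'X_{1..n}) :
  (mdeg m < d)%N -> (mftrunc d f)@_m = mfcoef f m.
Proof.
move=> lt_md; rewrite /mftrunc raddf_sum /= (bigD1 (BMultinom lt_md)) //=.
rewrite mcoeffZ mcoeffX eqxx mulr1 big1 ?addr0 // => k nek.
rewrite mcoeffZ mcoeffX; case: eqP => [Ekm|]; last by rewrite mulr0.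
by case/negP: nek; apply/eqP/val_inj.
Qed.

Lemma mfcoef_mul_trunc (d : nat) f g (m : 'X_{1..n}) : (mdeg m < d)%N ->
  mfcoef (mfps_mul f g) m = (mftrunc d f * mftrunc d g)@_m.
Proof.
move=> lt_md; rewrite mcoeffM /=; apply: eq_bigr => k _.
by rewrite !mcoeff_mftrunc // (leq_trans (bmdeg _)).
Qed.

Lemma mcoeffM_congr (p p' q q' : {mpoly A[n]}) (m : 'X_{1..n}) :
    (forall k : 'X_{1..n}, (mdeg k <= mdeg m)%N -> p@_k = p'@_k) ->
    (forall k : 'X_{1..n}, (mdeg k <= mdeg m)%N -> q@_k = q'@_k) ->
  (p * q)@_m = (p' * q')@_m.
Proof.
move=> eqp eqq; rewrite !mcoeffM; apply: eq_bigr => k _.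
by rewrite eqp ?eqq // -ltnS bmdeg.
Qed.

Fact mfps_mulA : associative mfps_mul.
Proof.
move=> f g h; apply: mfpsP => m; pose d := (mdeg m).+1.
rewrite !(@mfcoef_mul_trunc d) //.
transitivity (mftrunc d f * (mftrunc d g * mftrunc d h))@_m.
  apply: mcoeffM_congr => // k le_km.
  by rewrite mcoeff_mftrunc // (@mfcoef_mul_trunc d).
rewrite mulrA; apply: mcoeffM_congr => // k le_km.
by rewrite mcoeff_mftrunc // (@mfcoef_mul_trunc d).
Qed.

Fact mfps_mulC : commutative mfps_mul.
Proof.
move=> f g; apply: mfpsP => m.
by rewrite !(@mfcoef_mul_trunc (mdeg m).+1) // mulrC.
Qed.

Fact mfps_mul1 : left_id mfps_one mfps_mul.
Proof.
move=> f; apply: mfpsP => m; pose d := (mdeg m).+1.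
rewrite (@mfcoef_mul_trunc d) //.
transitivity (1 * mftrunc d f)@_m; last by rewrite mul1r mcoeff_mftrunc.
by apply: mcoeffM_congr => // k le_km; rewrite mcoeff_mftrunc // mcoeff1.
Qed.

Fact mfps_mulDl : left_distributive mfps_mul +%R.
Proof.
move=> f g h; apply: mfpsP => m /=; rewrite -big_split /=.
by apply: eq_bigr => k _; rewrite mulrDl.
Qed.

Fact mfps_oner_neq0 : mfps_one != 0.
Proof.
apply/eqP => /(congr1 (fun f => mfcoef f 0%MM)) /= /eqP.
by rewrite eqxx oner_eq0.
Qed.

HB.instance Definition _ := GRing.Zmodule_isComNzRing.Build (mfps n A)
  mfps_mulA mfps_mulC mfps_mul1 mfps_mulDl mfps_oner_neq0.

End MFpsRing.

Section Differential.
Context (n : nat) (A : comNzRingType).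
Implicit Types f P : mfps n A.

Definition mfderiv (i : 'I_n) f : mfps n A :=
  MFps (fun m => mfcoef f (m + U_(i))%MM *+ (m i).+1).

(* The partial derivative of multi-order J, as mderivm for {mpoly A[n]}. *)
Definition mfderivm (J : 'X_{1..n}) f : mfps n A :=
  foldr (fun i => iter (J i) (mfderiv i)) f (enum 'I_n).

Definition laplacian f : mfps n A := \sum_(i < n) mfderiv i (mfderiv i f).

Definition hessian P : 'M[mfps n A]_n :=
  \matrix_(i, j) mfderiv i (mfderiv j P).

Definition hes_u (m : nat) P : mfps n A := \tr (hessian P ^+ m).

Definition lap_v (m : nat) P : mfps n A := iter m laplacian (P ^+ m).

End Differential.

Definition ideal_gen (B : comNzRingType) (S : set B) : set B :=
  [set f | exists2 r : seq (B * B),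
     (forall p, p \in r -> S p.2) & f = \sum_(p <- r) p.1 * p.2].

(* The ideal generated by w 1, ..., w k and all their partial derivatives
   (J = 0 gives the w m themselves). *)
Definition diff_ideal (n : nat) (A : comNzRingType) (k : nat)
    (w : nat -> mfps n A) : set (mfps n A) :=
  ideal_gen [set f | exists m : nat, exists J : 'X_{1..n},
     (1 <= m <= k)%N /\ f = mfderivm J (w m)].

Definition idealU (n : nat) (A : comNzRingType) (k : nat) (P : mfps n A) :=
  diff_ideal k (fun m => hes_u m P).

Definition idealV (n : nat) (A : comNzRingType) (k : nat) (P : mfps n A) :=
  diff_ideal k (fun m => lap_v m P).

Definition avar (n : nat) : choiceType := {I : 'X_{1..n} | (2 <= mdeg I)%N}.

(* C[a]: the monoid algebra over C of the free commutative monoid on the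
   (infinitely many) variables a_I. *)
Definition Ca (R : realType) (n : nat) : comNzRingType :=
  malg (cmonom (avar n)) R[i].

Definition avarX (R : realType) (n : nat) (I : avar n) : Ca R n :=
  mkmalgU (ucm I) 1.

Definition univP (R : realType) (n : nat) : mfps n (Ca R n) :=
  MFps (fun I => if insub I is Some a then avarX R (a : avar n) else 0).

(* Main.v *)
(* Let Q be the power series in t over the ring of power series in z with
   Q(0) = P and dQ/dt = <grad Q, grad Q>, and write Q = sum_j q_j t^j.
   - Along the derivation X = d/dt - 2 <grad Q, grad> the Hessian H of Q
     satisfies X H = 2 H^2, hence X (tr H^m) = 2m tr H^(m+1). Comparing
     coefficients of t, Delta q_j is a positive rational multiple of u_(j+1) modulo the
     differential ideal generated by u_1, ..., u_j.
   - Also (r+1) d(Q^r)/dt = Delta Q^(r+1) - (r+1) Q^r Delta Q, so q_j is a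
     positive rational multiple of Delta^j P^(j+1), and Delta q_j one of
     v_(j+1), modulo the differential ideal generated by
     Delta q_0, ..., Delta q_(j-1).
   By triangularity u_1, ..., u_k and v_1, ..., v_k both generate the same
   differential ideal as Delta q_0, ..., Delta q_(k-1). *)
From HB Require Import structures.
Require Import Defs.
From mathcomp Require Import all_boot all_order all_algebra.
From mathcomp Require Import boolp classical_sets reals.
From mathcomp Require Import complex ring.
From mathcomp.multinomials Require Import -(notations) monalg.
From mathcomp Require Import mpoly.

Set Implicit Arguments.
Unset Strict Implicit.
Unset Printing Implicit Defensive.

Import GRing.Theory.

Local Open Scope ring_scope.
Local Open Scope classical_set_scope.

(** * Coefficients and derivations of formal power series *)

Section PowerSeries.
Context (n : nat) (A : comNzRingType).
Implicit Types f g : mfps n A.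

Lemma mfcoefM f g m : mfcoef (f * g) m =
  \sum_(k : 'X_{1..n < (mdeg m).+1, (mdeg m).+1} | m == (k.1 + k.2)%MM)
    mfcoef f k.1 * mfcoef g k.2.
Proof. by []. Qed.

Lemma mfcoefMn f k m : mfcoef (f *+ k) m = mfcoef f m *+ k.
Proof. by elim: k => [|k IHk] //; rewrite !mulrS /= IHk. Qed.

Lemma mfcoef_sum (I : Type) (r : seq I) (F : I -> mfps n A) m :
  mfcoef (\sum_(i <- r) F i) m = \sum_(i <- r) mfcoef (F i) m.
Proof. exact: (big_morph (fun f => mfcoef f m)). Qed.

Lemma mfcoef0M f g : mfcoef (f * g) 0%MM = mfcoef f 0%MM * mfcoef g 0%MM.
Proof.
rewrite (@mfcoef_mul_trunc _ _ 1) ?mdeg0 // rmorphM.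
by rewrite /= !mcoeff_mftrunc ?mdeg0.
Qed.

Lemma mfcoef0X f k : mfcoef (f ^+ k) 0%MM = mfcoef f 0%MM ^+ k.
Proof.
by elim: k => [|k IHk]; rewrite ?expr0 /= ?eqxx // !exprS mfcoef0M IHk.
Qed.

Fact mfderiv_is_zmod_morphism i : zmod_morphism (@mfderiv n A i).
Proof. by move=> f g; apply: mfpsP => m /=; rewrite -mulrnBl. Qed.

HB.instance Definition _ i := GRing.isZmodMorphism.Build _ _
  (@mfderiv n A i) (mfderiv_is_zmod_morphism i).

Lemma mfderivM i f g :
  mfderiv i (f * g) = mfderiv i f * g + f * mfderiv i g.
Proof.
(* Coefficient [m] of a derivative reads an exponent of degree [mdeg m + 1], so truncation below
   degree [e] reduces the claim to the Leibniz rule for polynomials. *)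
apply: mfpsP => m; set e := (mdeg m).+2.
have lt_e k : (mdeg k <= mdeg m)%N -> (mdeg (k + U_(i))%MM < e)%N.
  by move=> le_km; rewrite mdegD mdeg1 addn1 !ltnS.
have -> : mfcoef (mfderiv i (f * g)) m =
  mfcoef (mfps_mul f g) (m + U_(i))%MM *+ (m i).+1 by [].
have -> : mfcoef (mfderiv i f * g + f * mfderiv i g) m =
  mfcoef (mfps_mul (mfderiv i f) g) m + mfcoef (mfps_mul f (mfderiv i g)) m.
  by [].
rewrite !(@mfcoef_mul_trunc _ _ e) ?lt_e // -mcoeff_deriv mderivM mcoeffD.
congr (_ + _); apply: mcoeffM_congr => // k le_km.
  have lt_ke : (mdeg k < e)%N by rewrite ltnS leqW.
  by rewrite mcoeff_deriv !mcoeff_mftrunc ?lt_e.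
have lt_ke : (mdeg k < e)%N by rewrite ltnS leqW.
by rewrite mcoeff_deriv !mcoeff_mftrunc ?lt_e.
Qed.

Lemma mfderivC i j f : mfderiv i (mfderiv j f) = mfderiv j (mfderiv i f).
Proof.
have [-> //|ne_ij] := eqVneq i j; apply: mfpsP => m /=.
rewrite -!mulrnA !mnmDE !mnm1E (negPf ne_ij) eq_sym (negPf ne_ij) !addn0.
by rewrite mulnC -!addmA [(U_(i) + _)%MM]addmC.
Qed.

Definition mfmap (E : A -> A) f : mfps n A := MFps (fun m => E (mfcoef f m)).

Fact mfmap_is_zmod_morphism (E : {additive A -> A}) : zmod_morphism (mfmap E).
Proof. by move=> f g; apply: mfpsP => m /=; rewrite raddfB. Qed.

HB.instance Definition _ (E : {additive A -> A}) :=
  GRing.isZmodMorphism.Build _ _ (mfmap E) (mfmap_is_zmod_morphism E).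

Lemma mfmapM (E : {additive A -> A}) :
    (forall x y, E (x * y) = E x * y + x * E y) ->
  forall f g, mfmap E (f * g) = mfmap E f * g + f * mfmap E g.
Proof.
move=> EM f g; apply: mfpsP => m /=.
by rewrite raddf_sum -big_split; apply: eq_bigr => k _; rewrite EM.
Qed.

Lemma mfderiv_map i (E : {additive A -> A}) f :
  mfderiv i (mfmap E f) = mfmap E (mfderiv i f).
Proof. by apply: mfpsP => m /=; rewrite raddfMn. Qed.

Definition mfagree d f g :=
  forall m, (mdeg m < d)%N -> mfcoef f m = mfcoef g m.

Lemma mfagreeM d f f' g g' :
  mfagree d f f' -> mfagree d g g' -> mfagree d (f * g) (f' * g').
Proof.
move=> eqf eqg m lt_md; rewrite !mfcoefM; apply: eq_bigr => k _.
by rewrite eqf ?eqg // (leq_trans (bmdeg _)).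
Qed.

Section Ideal.
Variable I : set A.
Hypotheses (I0 : I 0) (ID : forall x y, I x -> I y -> I (x + y)).
Hypothesis IM : forall x y, I y -> I (x * y).

Lemma mfcoefM_ideal f g m :
    (forall k, (mdeg k <= mdeg m)%N -> I (mfcoef g k)) ->
  I (mfcoef (f * g) m).
Proof.
move=> Ig; rewrite mfcoefM; apply: big_ind => // k _.
by apply/IM/Ig; rewrite -ltnS bmdeg.
Qed.

End Ideal.

End PowerSeries.

(** * Fixed points of degree-raising maps *)

Section FixedPoint.
Context (n : nat) (A : comNzRingType) (Phi : mfps n A -> mfps n A).
Hypothesis Phi_contract :
  forall d f g, mfagree d f g -> mfagree d.+1 (Phi f) (Phi g).

(** The iterates of [Phi] from 0 stabilise degree by degree; the limit reads coefficient [m] in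
    iterate [mdeg m + 1], where it is already final. *)
Lemma mfps_fixpoint : exists f, Phi f = f.
Proof.
pose it d := iter d Phi 0.
have itD d e : mfagree d (it d) (it (d + e)%N).
  by elim: d => [|d IHd] // ; rewrite addSn; apply: Phi_contract.
pose f : mfps n A := MFps (fun m => mfcoef (it (mdeg m).+1) m).
have fit d : mfagree d f (it d).
  by move=> m lt_md; rewrite /= -(subnKC lt_md) -itD.
exists f; apply: mfpsP => m.
by rewrite (Phi_contract (@fit (mdeg m)) (ltnSn _)).
Qed.

End FixedPoint.

(** * Differential ideals in a ring with additive operators *)

Section Derivations.
Context (n : nat) (B : comNzRingType) (D : 'I_n -> {additive B -> B}).

Definition dlap x := \sum_(i < n) D i (D i x).

Definition dhess x : 'M[B]_n := \matrix_(i, j) D i (D j x).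

Lemma dlapB x y : dlap (x - y) = dlap x - dlap y.
Proof. by rewrite -sumrB; apply: eq_bigr => i _; rewrite !raddfB. Qed.

Lemma dlapMn x k : dlap (x *+ k) = dlap x *+ k.
Proof. by rewrite -sumrMnl; apply: eq_bigr => i _; rewrite !raddfMn. Qed.

Lemma trace_dhess x : \tr (dhess x) = dlap x.
Proof. by apply: eq_bigr => i _; rewrite mxE. Qed.

(** The closure form of the differential ideal makes inclusions provable by induction on
    membership. *)
Inductive dideal (S : set B) : set B :=
| dideal_gen x : S x -> dideal S x
| dideal0 : dideal S 0
| didealD x y : dideal S x -> dideal S y -> dideal S (x + y)
| didealM x y : dideal S y -> dideal S (x * y)
| dideal_der i x : dideal S x -> dideal S (D i x).

Lemma didealS S T : S `<=` dideal T -> dideal S `<=` dideal T.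
Proof.
move=> sST x; elim=> {x} [x /sST //||x y _ Tx _ Ty|x y _ Ty|i x _ Tx].
- exact: dideal0.
- exact: didealD.
- exact: didealM.
- exact: dideal_der.
Qed.

Lemma didealN S x : dideal S x -> dideal S (- x).
Proof. by rewrite -mulN1r; apply: didealM. Qed.

Lemma didealB S x y : dideal S x -> dideal S y -> dideal S (x - y).
Proof. by move=> Sx /didealN; apply: didealD. Qed.

Lemma didealMn S x k : dideal S x -> dideal S (x *+ k).
Proof. by rewrite -mulr_natl; apply: didealM. Qed.

Lemma dideal_sum S (F : 'I_n -> B) :
  (forall i, dideal S (F i)) -> dideal S (\sum_i F i).
Proof.
by move=> SF; apply: big_ind => //; [apply: dideal0 | apply: didealD].
Qed.

Lemma dideal_lap S x : dideal S x -> dideal S (dlap x).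
Proof. by move=> Sx; apply: dideal_sum => i; do 2!apply: dideal_der. Qed.

Definition below (s : nat -> B) k : set B :=
  [set x | exists2 j, (j < k)%N & x = s j].

Lemma dideal_belowS s k l :
  (k <= l)%N -> dideal (below s k) `<=` dideal (below s l).
Proof.
move=> le_kl; apply: didealS => _ [j lt_jk ->]; apply: dideal_gen.
by exists j => //; apply: leq_trans le_kl.
Qed.

Lemma dideal_below s k j : (j < k)%N -> dideal (below s k) (s j).
Proof. by move=> lt_jk; apply: dideal_gen; exists j. Qed.

Hypothesis Bdiv : forall j, exists c : B, c * j.+1%:R = 1.

Lemma dideal_divn S x j : (0 < j)%N -> dideal S (x *+ j) -> dideal S x.
Proof.
case: j => // j _ Sx; have [c cj] := Bdiv j.
by rewrite -[x]mul1r -cj -mulrA mulr_natl; apply: didealM.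
Qed.

(* Congruence up to a nonzero rational factor. *)
Definition dcong S x y :=
  exists a b, [/\ (0 < a)%N, (0 < b)%N & dideal S (x *+ a - y *+ b)].

Lemma dcong_mem S x y : dcong S x y -> dideal S y -> dideal S x.
Proof.
move=> [a [b [a_gt0 _ Sxy]]] Sy; apply: (dideal_divn a_gt0).
by rewrite -(subrK (y *+ b) (x *+ a)); apply: didealD => //; apply: didealMn.
Qed.

Lemma dcong_sym S x y : dcong S x y -> dcong S y x.
Proof.
move=> [a [b [a_gt0 b_gt0 Sxy]]]; exists b, a; split=> //.
by rewrite -opprB; apply: didealN.
Qed.

(** Each [s j] lies in the ideal of the [t i] with [i <= j] at once. The converse needs strong
    induction: the congruence for [t j] holds modulo earlier [t i], which must first be known to lie
    in the ideal of [s]. *)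
Lemma dideal_triangular s t k :
    (forall j, dcong (below t j) (s j) (t j)) ->
  dideal (below s k) = dideal (below t k).
Proof.
move=> st; rewrite eqEsubset; split; apply: didealS => _ [j lt_jk ->].
  apply: (dideal_belowS lt_jk); apply: (@dcong_mem _ _ (t j)).
    have [a [b [a_gt0 b_gt0 Sst]]] := st j.
    by exists a, b; split=> //; apply: dideal_belowS Sst.
  exact: dideal_below.
elim/ltn_ind: j lt_jk => j IHj lt_jk.
have [a [b [a_gt0 b_gt0 Sst]]] := dcong_sym (st j).
apply: (@dcong_mem _ _ (s j)); last exact: dideal_below.
exists a, b; split=> //; apply: didealS Sst => _ [i lt_ij ->].
by apply: IHj => //; apply: ltn_trans lt_jk.
Qed.

End Derivations.

(** * Identities for the evolution equation of [Q] *)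

Section Evolution.
Context (n : nat) (C : comNzRingType) (D : 'I_n -> {additive C -> C}).
Context (d : {additive C -> C}) (Q : C).
Hypothesis DM : forall i x y, D i (x * y) = D i x * y + x * D i y.
Hypothesis DC : forall i j x, D i (D j x) = D j (D i x).
Hypothesis dM : forall x y, d (x * y) = d x * y + x * d y.
Hypothesis dD : forall i x, d (D i x) = D i (d x).
Hypothesis dQ : d Q = \sum_i D i Q * D i Q.

Definition transport x := \sum_i D i Q * D i x *+ 2.

(** The derivation [X]. The factor 2 in [transport] makes [X] kill each [D i Q], since [D i] of the
    squared gradient is [transport (D i Q)]. *)
Definition material x := d x - transport x.

Fact material_is_zmod_morphism : zmod_morphism material.
Proof.
move=> x y; rewrite /material raddfB /=.
have -> : transport (x - y) = transport x - transport y; last by ring.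
by rewrite -sumrB; apply: eq_bigr => i _; rewrite raddfB /=; ring.
Qed.

HB.instance Definition _ := GRing.isZmodMorphism.Build _ _
  material material_is_zmod_morphism.

Lemma materialM x y : material (x * y) = material x * y + x * material y.
Proof.
rewrite /material dM mulrBl mulrBr addrACA -opprD; congr (_ - _).
rewrite mulr_suml mulr_sumr -big_split; apply: eq_bigr => i _ /=.
by rewrite DM; ring.
Qed.

Lemma derivation1 (E : {additive C -> C}) :
  (forall x y, E (x * y) = E x * y + x * E y) -> E 1 = 0.
Proof.
move=> EM; have := EM 1 1; rewrite !mulr1 mul1r => /eqP.
by rewrite -subr_eq0 opprD addrA subrr sub0r oppr_eq0 => /eqP.
Qed.

Lemma derivationX (E : {additive C -> C}) x k :
    (forall x y, E (x * y) = E x * y + x * E y) ->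
  E (x ^+ k.+1) = x ^+ k * E x *+ k.+1.
Proof.
move=> EM; elim: k => [|k IHk]; first by rewrite expr1 expr0 mul1r.
by rewrite exprS EM IHk exprS [in RHS]mulrS -mulrnAr mulrA mulrC; ring.
Qed.

(** Apply [D i] and [D j] to the squared gradient: the third-order terms form [transport] of the
    Hessian entry and cancel, and the products of second derivatives form the squared Hessian. *)
Lemma material_hess i j :
  material (dhess D Q i j) = (dhess D Q ^+ 2) i j *+ 2.
Proof.
rewrite expr2 -mulmxE !mxE /material !dD dQ [D j _]raddf_sum [D i _]raddf_sum.
rewrite -sumrMnl -sumrB; apply: eq_bigr => k _.
by rewrite !mxE DM raddfD /= !DM (DC k i) !(DC k j); ring.
Qed.

Lemma material_hessX m i j :
  material ((dhess D Q ^+ m) i j) = (dhess D Q ^+ m.+1) i j *+ (2 * m).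
Proof.
elim: m i j => [|m IHm] i j.
  by rewrite expr0 mxE muln0 mulr0n raddfMn /= (derivation1 materialM) mul0rn.
have := material_hess; move: (dhess D Q) IHm => H IHm materialH.
have -> : (H ^+ m.+2) i j *+ (2 * m.+1) =
    (H ^+ 2 *m H ^+ m) i j *+ 2 + (H *m H ^+ m.+1) i j *+ (2 * m).
  by rewrite !mulmxE -exprD -exprS add2n -mulrnDr mulnS.
rewrite [in LHS]exprS -[in LHS]mulmxE [in LHS]mxE raddf_sum.
rewrite [X in X *+ 2]mxE [X in _ + X *+ _]mxE -!sumrMnl -big_split.
apply: eq_bigr => k _ /=.
by rewrite materialM materialH IHm mulrnAl mulrnAr.
Qed.

Lemma material_trace m : material (\tr (dhess D Q ^+ m)) =
  \tr (dhess D Q ^+ m.+1) *+ (2 * m).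
Proof.
rewrite /mxtrace raddf_sum -sumrMnl.
by apply: eq_bigr => i _; apply: material_hessX.
Qed.

(** Both sides equal [r (r+1) Q^(r-1)] times the squared gradient of [Q]; [r = 0] is treated apart
    because of the exponent. *)
Lemma d_exp r : d (Q ^+ r) *+ r.+1 =
  dlap D (Q ^+ r.+1) - Q ^+ r * dlap D Q *+ r.+1.
Proof.
have -> : dlap D (Q ^+ r.+1) =
    \sum_i (D i (Q ^+ r) * D i Q + Q ^+ r * D i (D i Q)) *+ r.+1.
  by apply: eq_bigr => i _; rewrite derivationX // raddfMn /= DM.
rewrite mulr_sumr -sumrMnl -sumrB.
case: r => [|r].
  rewrite !expr0 derivation1 // mul0rn big1 // => i _.
  by rewrite derivation1 //; ring.
rewrite derivationX // dQ mulr_sumr -!sumrMnl; apply: eq_bigr => i _.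
by rewrite derivationX //; ring.
Qed.

End Evolution.

(** * Power series in the single variable [t], as [mfps 1 B] *)

Section Univariate.
Context (B : comNzRingType).
Implicit Types f g : mfps 1 B.

Definition tmon j : 'X_{1..1} := (U_(ord0) *+ j)%MM.

Definition tcoef f j := mfcoef f (tmon j).

Lemma tmonE j : tmon j ord0 = j.
Proof. by rewrite mulmnE mnm1E eqxx mul1n. Qed.

Lemma tmon0 : tmon 0 = 0%MM.
Proof. exact: mulm0n. Qed.

Lemma mdeg_tmon j : mdeg (tmon j) = j.
Proof. by rewrite mdegE big_ord1 tmonE. Qed.

Lemma tmon_mdeg m : tmon (mdeg m) = m.
Proof. by apply/mnmP => i; rewrite !ord1 tmonE mdegE big_ord1. Qed.

Lemma tcoef_deriv f j : tcoef (mfderiv ord0 f) j = tcoef f j.+1 *+ j.+1.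
Proof. by rewrite /tcoef /= tmonE addmC -mulmS. Qed.

Lemma tcoefMn f k j : tcoef (f *+ k) j = tcoef f j *+ k.
Proof. exact: mfcoefMn. Qed.

End Univariate.

(** * Solving the evolution equation with initial value [P] *)

Section Cauchy.
Context (n : nat) (B : comNzRingType) (D : 'I_n -> {additive B -> B}).
Hypothesis Bdiv : forall j, exists c : B, c * j.+1%:R = 1.

Definition tlift i : {additive mfps 1 B -> mfps 1 B} := mfmap (D i).

Lemma cauchy_solution P : exists2 Q : mfps 1 B, tcoef Q 0 = P &
  mfderiv ord0 Q = \sum_i tlift i Q * tlift i Q.
Proof.
have [c cP] := choice Bdiv.
pose F (Q : mfps 1 B) := \sum_i tlift i Q * tlift i Q.
(* [Phi] integrates [F Q] in [t] with constant term [P], [c j] being the inverse of [j+1];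
   integration raises the degree by one, hence [Phi] contracts. *)
pose Phi Q : mfps 1 B := MFps (fun m => if m ord0 is j.+1 then
  c j * mfcoef (F Q) (m - U_(ord0))%MM else P).
have [d f g eq_fg m lt_md /=|Q QP] := @mfps_fixpoint _ _ Phi.
  case Em: (m ord0) => [|j] //; rewrite /F !mfcoef_sum; congr (_ * _).
  have lt_d : (mdeg (m - U_(ord0))%MM < d)%N.
    have /submK mK : (U_(ord0) <= m)%MM.
      by apply/mnm_lepP => i; rewrite (ord1 i) mnm1E [m _]Em.
    by rewrite -mK mdegD mdeg1 addn1 in lt_md.
  by apply: eq_bigr => i _; apply: mfagreeM lt_d => k lt_kd /=; rewrite eq_fg.
exists Q; rewrite -QP; first by rewrite /tcoef /= tmonE.
apply: mfpsP => m; rewrite /= mnmDE mnm1E eqxx addn1 QP addmK.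
by rewrite -mulr_natl mulrA [_ * c _]mulrC cP mul1r.
Qed.

End Cauchy.

(** * Comparing coefficients of [t] *)

Section Comparison.
Context (n : nat) (B : comNzRingType) (D : 'I_n -> {additive B -> B}).
Hypothesis DM : forall i x y, D i (x * y) = D i x * y + x * D i y.
Hypothesis DC : forall i j x, D i (D j x) = D j (D i x).
Hypothesis Bdiv : forall j, exists c : B, c * j.+1%:R = 1.
Context (P : B) (Q : mfps 1 B).
Hypothesis Q0 : tcoef Q 0 = P.
Hypothesis dQ : mfderiv ord0 Q = \sum_i tlift D i Q * tlift D i Q.

Local Notation DD := (tlift D).

Let DDM i f g : DD i (f * g) = DD i f * g + f * DD i g.
Proof. exact: mfmapM. Qed.

Let DDC i j f : DD i (DD j f) = DD j (DD i f).
Proof. by apply: mfpsP => m /=. Qed.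

Let dDD i f : mfderiv ord0 (DD i f) = DD i (mfderiv ord0 f).
Proof. exact: mfderiv_map. Qed.

Lemma tcoef_lap f j : tcoef (dlap DD f) j = dlap D (tcoef f j).
Proof. exact: mfcoef_sum. Qed.

Lemma tcoefM_dideal S (f g : mfps 1 B) j :
    (forall k, (k <= j)%N -> dideal D S (tcoef g k)) ->
  dideal D S (tcoef (f * g) j).
Proof.
move=> Sg; apply: mfcoefM_ideal; last first.
- by move=> m; rewrite mdeg_tmon -{2}[m]tmon_mdeg; apply: Sg.
- exact: didealM.
- exact: didealD.
- exact: dideal0.
Qed.

Lemma transport_dideal S f j :
    (forall k, (k <= j)%N -> dideal D S (tcoef f k)) ->
  dideal D S (tcoef (transport DD Q f) j).
Proof.
move=> Sf; rewrite /tcoef mfcoef_sum; apply: dideal_sum => i.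
rewrite mfcoefMn; apply: didealMn; apply: tcoefM_dideal => k le_kj.
by apply: dideal_der; apply: Sf.
Qed.

Lemma tcoef0_hessX m i j :
  tcoef ((dhess DD Q ^+ m) i j) 0 = (dhess D P ^+ m) i j.
Proof.
rewrite /tcoef tmon0.
elim: m i j => [|m IHm] i j.
  by rewrite !expr0 !mxE mfcoefMn /= eqxx.
rewrite !exprS -!mulmxE [in LHS]mxE [in RHS]mxE mfcoef_sum.
apply: eq_bigr => k _; rewrite mfcoef0M IHm !mxE -Q0.
by congr (_ * _).
Qed.

Lemma tcoef0_trace m :
  tcoef (\tr (dhess DD Q ^+ m)) 0 = \tr (dhess D P ^+ m).
Proof.
rewrite /tcoef mfcoef_sum.
by apply: eq_bigr => i _; apply: tcoef0_hessX.
Qed.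

Lemma tcoef_traceS m j :
  tcoef (\tr (dhess DD Q ^+ m)) j.+1 *+ j.+1 =
  tcoef (transport DD Q (\tr (dhess DD Q ^+ m))) j +
  tcoef (\tr (dhess DD Q ^+ m.+1)) j *+ (2 * m).
Proof.
rewrite -tcoef_deriv -tcoefMn.
rewrite -(material_trace DDM DDC (@mfderivM _ _ ord0) dDD dQ).
by rewrite /material /tcoef /= addrC subrK.
Qed.

Lemma tcoef_expS r j :
  tcoef (Q ^+ r) j.+1 *+ (j.+1 * r.+1) =
  dlap D (tcoef (Q ^+ r.+1) j) - tcoef (Q ^+ r * dlap DD Q) j *+ r.+1.
Proof.
rewrite mulrnA -tcoef_deriv -!tcoefMn -tcoef_lap.
by rewrite (d_exp DDM (@mfderivM _ _ ord0) dQ).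
Qed.

(** The power [m] must vary: one step in [t] trades coefficient [j+1] of power [m+1] for coefficient
    [j] of power [m+2], which preserves [m + j]. *)
Lemma tcoef_trace_dcong j m :
  dcong D (below (fun l => \tr (dhess D P ^+ l.+1)) (m + j))
    (tcoef (\tr (dhess DD Q ^+ m.+1)) j) (\tr (dhess D P ^+ (m + j).+1)).
Proof.
elim/ltn_ind: j m => -[|j] IHj m.
  exists 1%N, 1%N; split=> //; rewrite tcoef0_trace addn0 subrr.
  exact: dideal0.
have [a [b [a_gt0 b_gt0 wu]]] := IHj j (ltnSn j) m.+1.
(* [j+1] comes from differentiation in [t], and [2(m+1)] from [X] acting on the trace. *)
exists (j.+1 * a)%N, (b * (2 * m.+1))%N.
split; rewrite ?muln_gt0 ?a_gt0 ?b_gt0 //.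
rewrite mulrnA tcoef_traceS mulrnDl -addrA addnS -addSn.
rewrite [_ *+ (2 * _) *+ a]mulrnAC [_ *+ (b * _)]mulrnA -mulrnBl.
apply: didealD; last exact: didealMn.
(* The transport term involves only coefficients [k <= j] of the same trace, which by induction are
   multiples of earlier generators modulo still earlier ones. *)
apply: didealMn; apply: transport_dideal => k le_kj.
have lt_mk : (m + k < m.+1 + j)%N by rewrite addSn ltnS leq_add2l.
apply: (dcong_mem Bdiv (y := \tr (dhess D P ^+ (m + k).+1))).
  have [c [e [c_gt0 e_gt0 wuk]]] := IHj k le_kj m.
  by exists c, e; split=> //; apply: dideal_belowS wuk; apply: ltnW.
by apply: (dideal_below D (fun l => \tr (dhess D P ^+ l.+1))).
Qed.

(** Induction on [j] with [r + j] fixed: by [d_exp], coefficient [j+1] of [Q^r] is a rational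
    multiple of the Laplacian of coefficient [j] of [Q^(r+1)], up to terms containing the Laplacians
    of [q_0, ..., q_j]. *)
Lemma tcoef_exp_dcong j r :
  dcong D (below (fun l => dlap D (tcoef Q l)) j)
    (tcoef (Q ^+ r) j) (iter j (dlap D) (P ^+ (r + j))).
Proof.
elim: j r => [|j IHj] r.
  exists 1%N, 1%N; split=> //.
  rewrite addn0 /= -Q0 /tcoef tmon0 mfcoef0X subrr.
  exact: dideal0.
have [a [b [a_gt0 b_gt0 eP]]] := IHj r.+1.
exists (j.+1 * r.+1 * a)%N, b; split; rewrite ?muln_gt0 //.
rewrite mulrnA tcoef_expS addnS -addSn iterS mulrnBl addrAC -!dlapMn -dlapB.
apply: didealB; first by apply: dideal_lap; apply: dideal_belowS eP.
do 2!apply: didealMn; apply: tcoefM_dideal => k le_kj.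
by rewrite tcoef_lap; apply: (dideal_below D (fun l => dlap D (tcoef Q l))).
Qed.

End Comparison.

(** * Equality of the two differential ideals over an abstract ring *)

Section TraceLaplacian.
Context (n : nat) (B : comNzRingType) (D : 'I_n -> {additive B -> B}).
Hypothesis DM : forall i x y, D i (x * y) = D i x * y + x * D i y.
Hypothesis DC : forall i j x, D i (D j x) = D j (D i x).
Hypothesis Bdiv : forall j, exists c : B, c * j.+1%:R = 1.

Lemma dideal_trace_laplacian P k :
  dideal D (below (fun l => \tr (dhess D P ^+ l.+1)) k) =
  dideal D (below (fun l => iter l.+1 (dlap D) (P ^+ l.+1)) k).
Proof.
have [Q Q0 dQ] := cauchy_solution D Bdiv P.
transitivity (dideal D (below (fun l => dlap D (tcoef Q l)) k)).
  symmetry; apply: (dideal_triangular Bdiv) => j.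
  (* For [m = 0] the trace is the Laplacian of [Q], with coefficients the Laplacians of the
     [q_j]. *)
  have := tcoef_trace_dcong DM DC Bdiv Q0 dQ j 0.
  by rewrite expr1 trace_dhess tcoef_lap.
symmetry; apply: (dideal_triangular Bdiv) => j; apply: dcong_sym.
have [a [b [a_gt0 b_gt0 eP]]] := tcoef_exp_dcong DM Q0 dQ j 1.
(* One more Laplacian turns the congruence for [q_j] into the one for its Laplacian. *)
exists a, b; split=> //; rewrite iterS -!dlapMn -dlapB.
by apply: dideal_lap; rewrite expr1 in eP.
Qed.

End TraceLaplacian.

(** * Ideals generated by all partial derivatives *)

Section DiffIdeal.
Context (n : nat) (A : comNzRingType).

(** The new derivative commutes inward to the unique place of [i] in the enumeration. *)
Lemma mfderiv_mfderivm i (J : 'X_{1..n}) (f : mfps n A) :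
  mfderiv i (mfderivm J f) = mfderivm (J + U_(i))%MM f.
Proof.
rewrite /mfderivm; have := mem_enum 'I_n i; have := enum_uniq 'I_n.
have iterC j l g : mfderiv i (iter l (mfderiv j) g) =
    iter l (mfderiv j) (mfderiv i g).
  by elim: l => //= l IHl; rewrite mfderivC IHl.
rewrite inE; elim: (enum 'I_n) => //= j s IHs /andP[js s_uniq].
rewrite inE mnmDE mnm1E; have [->|ne_ij] /= := eqVneq i j => si.
  rewrite addn1 iterS; congr (mfderiv j (iter _ _ _)).
  elim: s js {IHs s_uniq} => //= l s IHs; rewrite inE negb_or mnmDE mnm1E.
  by case/andP=> /negPf-> /IHs->; rewrite addn0.
by rewrite addn0 iterC IHs.
Qed.

Lemma diff_idealE k (w : nat -> mfps n A) :
  diff_ideal k w = dideal (@mfderiv n A) (below (fun l => w l.+1) k).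
Proof.
rewrite eqEsubset; split=> x.
  case=> r rS ->; rewrite big_seq; apply: big_ind => [||p /rS].
  - exact: dideal0.
  - exact: didealD.
  case=> -[|m] [J []] //= lt_mk ->; apply: didealM.
  rewrite /mfderivm; elim: (enum 'I_n) => [|i s IHs] /=.
    by apply: dideal_gen; exists m.
  by elim: (J i) => //= l; apply: dideal_der.
elim=> {x} [x [m lt_mk ->]||x y _ [r rS ->] _ [s sS ->]|x y _ [r rS ->]|
    i x _ [r rS ->]].
- exists [:: (1, w m.+1)]; last by rewrite big_seq1 mul1r.
  move=> p; rewrite inE => /eqP ->; exists m.+1, 0%MM; split=> //=.
  rewrite /mfderivm; elim: (enum 'I_n) => //= i s <-.
  by rewrite mnm0E.
- by exists [::]; rewrite ?big_nil.
- exists (r ++ s); last by rewrite big_cat.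
  by move=> p; rewrite mem_cat => /orP[/rS|/sS].
- exists [seq (x * p.1, p.2) | p <- r].
    by move=> _ /mapP[p /rS ? ->].
  by rewrite big_map mulr_sumr; apply: eq_bigr => p _; rewrite mulrA.
(* The Leibniz rule on each summand; the derivative of a generator is again a generator. *)
exists ([seq (mfderiv i p.1, p.2) | p <- r] ++
    [seq (p.1, mfderiv i p.2) | p <- r]).
  move=> q; rewrite mem_cat => /orP[] /mapP[p /rS pS ->] //=.
  have [m [J [m_k ->]]] := pS; exists m, (J + U_(i))%MM.
  by rewrite mfderiv_mfderivm.
rewrite raddf_sum big_cat /= !big_map -big_split /=.
by apply: eq_bigr => p _; rewrite mfderivM.
Qed.

End DiffIdeal.

(** * Inverses of positive integers, and the universal series *)

Lemma mfps_natr_inv n (A : comNzRingType) j :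
  (exists c : A, c * j.+1%:R = 1) -> exists c : mfps n A, c * j.+1%:R = 1.
Proof.
case=> c cj; exists (MFps (fun m => c *+ (m == 0%MM))); apply: mfpsP => m.
by rewrite mulr_natr mfcoefMn /= mulrnAC -[c *+ _]mulr_natr cj.
Qed.

Lemma Ca_natr_inv (R : realType) n j : exists c : Ca R n, c * j.+1%:R = 1.
Proof.
exists ((j.+1%:R^-1 : R[i]) *: (1 : malg (cmonom (avar n)) R[i])).
rewrite mulr_natr -scaler_nat scalerA mulfV ?scale1r //.
by rewrite Num.Theory.pnatr_eq0.
Qed.

(* C is R[i], for R any model of the real numbers. *)
Theorem theorem4p1 (R : realType) (n : nat) (n_ge1 : (1 <= n)%N)
    (k : nat) (k_ge1 : (1 <= k)%N) :
  idealU k (univP R n) = idealV k (univP R n).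
Proof.
rewrite /idealU /idealV !diff_idealE.
apply: dideal_trace_laplacian.
- exact: mfderivM.
- exact: mfderivC.
by move=> j; apply/mfps_natr_inv/Ca_natr_inv.
Qed.
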